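(* Let $\delta=(\delta_1,\dots,\delta_n)$ be any permutation of $[n]$. Then for every $j\in[n]$, an optimal solution of the lifting problem $$\eta^{\delta}_{\delta_j}=\min_{S}\Big\{ f(a(S))-\sum_{i\in S\setminus\{\delta_j\}}\eta^{\delta}_i \;:\; S\subseteq\delta(j),\ |S\cap N_k|\le 1\ \ \forall k\in[t],\ \delta_j\in S\Big\}$$ is given by $$W^{\delta}_j:=\big(U^{\delta}_{h^{\delta}_j}\setminus\{\delta_{h^{\delta}_j}\}\big)\cup\{\delta_j\},$$ and the optimal value is $$\eta^{\delta}_{\delta_j}=f(a(W^{\delta}_j))-\sum_{i\in W^{\delta}_j\setminus\{\delta_j\}}\eta^{\delta}_i .$$
   Context: For a non-negative integer $m$, $[m]=\{1,\dots,m\}$ with $[0]=\varnothing$. Let $n,t$ be positive integers, $f:\mathbb{R}\to\mathbb{R}$ a concave function with $f(0)=0$, $a\in\mathbb{R}^n$ with non-negative entries, and $\{N_k\}_{k\in[t]}$ a partition of $[n]$ into consecutive blocks: with $i_0:=0$ and $i_k:=\sum_{j=1}^k|N_j|$, $N_k=\{i_{k-1}+1,\dots,i_k\}$. Within each block the entries of $a$ are ascending: $a_{i_{k-1}+1}\le a_{i_{k-1}+2}\le\cdots\le a_{i_k}$ for all $k\in[t]$. For $S\subseteq[n]$, $a(S):=\sum_{i\in S}a_i$. For a permutation $\delta=(\delta_1,\dots,\delta_n)$ of $[n]$, let $\delta(j):=\{\delta_1,\dots,\delta_j\}$ and $\delta(0)=\varnothing$. The lifting coefficients $\eta^\delta_{\delta_1},\eta^\delta_{\delta_2},\dots,\eta^\delta_{\delta_n}$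 are defined recursively, for $j=1,2,\dots,n$, as the optimal values of the lifting problems displayed in the claim. For $j\in\{0,1,\dots,n\}$, $U^\delta_j:=\bigcup_{k=1}^t\{\max_{i\in N_k\cap\delta(j)}i\}$, with the convention $\{\max_{i\in\varnothing}i\}=\varnothing$. For $j\in[n]$, with $k\in[t]$ such that $\delta_j\in N_k$, define $h^\delta_j:=j$ if $\delta_j=\max_{i\in N_k\cap\delta(j)}i$, and $h^\delta_j:=\min\{\ell\in[j-1]:\delta_\ell>\delta_j,\ \delta_\ell\in N_k\}$ if $\delta_j<\max_{i\in N_k\cap\delta(j)}i$. *)

(* Defs.v *)
From mathcomp Require Import all_boot all_order all_fingroup all_algebra.
From mathcomp Require Import reals.

Set Implicit Arguments.
Unset Strict Implicit.
Unset Printing Implicit Defensive.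

Import Order.TTheory GRing.Theory Num.Theory.
Local Open Scope ring_scope.

(* All indices are shifted by one: [n] is 'I_n and [t] is 'I_t, so the entry
   delta_j of a permutation (1 <= j <= n) is [delta i] with i = j - 1.  Only the
   prefix lengths (the arguments of [prefix] and [blockmaxima]) are unshifted. *)

Definition concave (R : realType) (f : R -> R) : Prop :=
  forall x y c : R, 0 <= c <= 1 ->
    c * f x + (1 - c) * f y <= f (c * x + (1 - c) * y).

Section Blocks.
Context {n t : nat}.
Implicit Types (N : 'I_t -> {set 'I_n}) (delta : {perm 'I_n}).

Definition blocks N : {set {set 'I_n}} := [set N k | k : 'I_t].

Definition block_bound N (m : nat) : nat := (\sum_(l < t | l < m) #|N l|)%N.

(* [injective N] makes the indexed family, and not only its set of values,
   pairwise disjoint; [partition] excludes empty blocks. *)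
Definition consecutive_partition N : Prop :=
  [/\ injective N, partition (blocks N) [set: 'I_n]
    & forall k : 'I_t,
        N k = [set i : 'I_n | (block_bound N k <= i < block_bound N k.+1)%N]].

Definition block_ascending {R : realType} N (a : 'rV[R]_n) : Prop :=
  forall (k : 'I_t) (i i' : 'I_n),
    i \in N k -> i' \in N k -> (i <= i')%N -> a 0 i <= a 0 i'.

(* {max A}, or the empty set if A is empty *)
Definition max_singleton (A : {set 'I_n}) : {set 'I_n} :=
  [set i in A | [forall l in A, (l <= i)%N]].

Definition prefix delta (m : nat) : {set 'I_n} :=
  [set delta i | i : 'I_n & (i < m)%N].

Definition blockmaxima N delta (m : nat) : {set 'I_n} :=
  \bigcup_(k < t) max_singleton (N k :&: prefix delta m).

Definition block_of N (i : 'I_n) : {set 'I_n} := pblock (blocks N) i.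

(* In the second case the minimum is over a nonempty set whenever N is a
   partition, so the default value j of [arg min] plays no role. *)
Definition hpos N delta (j : 'I_n) : 'I_n :=
  let B := block_of N (delta j) in
  if delta j \in max_singleton (B :&: prefix delta j.+1) then j
  else [arg min_(l < j | [&& (l < j)%N, (delta j < delta l)%N & delta l \in B]) l].

Definition wset N delta (j : 'I_n) : {set 'I_n} :=
  let h := hpos N delta j in
  (blockmaxima N delta h.+1 :\ delta h) :|: [set delta j].

Definition feasible N delta (j : 'I_n) (S : {set 'I_n}) : bool :=
  [&& S \subset prefix delta j.+1,
      [forall k : 'I_t, (#|S :&: N k| <= 1)%N]
    & delta j \in S].

End Blocks.

Section Lifting.
Context {R : realType} {n t : nat}.
Implicit Types (f : R -> R) (a : 'rV[R]_n) (N : 'I_t -> {set 'I_n})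
  (delta : {perm 'I_n}) (eta : 'I_n -> R).

Definition objective f a delta eta (j : 'I_n) (S : {set 'I_n}) : R :=
  f (\sum_(i in S) a 0 i) - \sum_(i in S :\ delta j) eta i.

(* The minimum of the lifting problem; for a partition, [set delta j] is
   feasible (see [feasible1]). *)
Definition lifting_value f a N delta eta (j : 'I_n) : R :=
  objective f a delta eta j
    [arg min_(S < [set delta j] | feasible N delta j S)
        objective f a delta eta j S]%O.

(* [lifting_upto m] holds the coefficients of delta_1, ..., delta_m, and 0 at
   all other indices. *)
Fixpoint lifting_upto f a N delta (m : nat) : 'I_n -> R :=
  if m is p.+1 then
    fun i => let j := (delta^-1)%g i in
      if j == p :> nat
      then lifting_value f a N delta (lifting_upto f a N delta p) j
      else lifting_upto f a N delta p i
  else fun=> 0.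

Definition lifting_coef f a N delta : 'I_n -> R := lifting_upto f a N delta n.

Lemma feasible1 N delta j : feasible N delta j [set delta j].
Proof.
apply/and3P; split; last exact: set11.
- by rewrite sub1set; apply/imsetP; exists j; rewrite ?inE.
- apply/forallP => k; rewrite -(cards1 (delta j)).
  exact: subset_leq_card (subsetIl _ _).
Qed.

Lemma eq_objective f a N delta eta eta' (j : 'I_n) S :
    (forall l : 'I_n, (l < j)%N -> eta (delta l) = eta' (delta l)) ->
    feasible N delta j S ->
  objective f a delta eta j S = objective f a delta eta' j S.
Proof.
move=> eq_eta /and3P[/subsetP sS _ _]; congr (_ - _).
apply: eq_bigr => i /setD1P[ne_i /sS /imsetP[l]].
rewrite inE ltnS leq_eqVlt => /orP[/eqP/val_inj-> def_i|lt_l ->].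
  by rewrite def_i eqxx in ne_i.
exact: eq_eta.
Qed.

Lemma lifting_valueP f a N delta eta (j : 'I_n) :
  (exists2 S, feasible N delta j S &
     lifting_value f a N delta eta j = objective f a delta eta j S) /\
  (forall S, feasible N delta j S ->
     lifting_value f a N delta eta j <= objective f a delta eta j S).
Proof.
rewrite /lifting_value; case: arg_minP; first exact: feasible1.
by move=> S fS minS; split => //; exists S.
Qed.

Lemma lifting_upto_stable f a N delta (l : 'I_n) m : (l < m)%N ->
  lifting_upto f a N delta m (delta l) =
  lifting_value f a N delta (lifting_upto f a N delta l) l.
Proof.
elim: m => // m IHm; rewrite ltnS leq_eqVlt /= permK.
case: eqP => [-> //|_] /= lt_lm; exact: IHm.
Qed.

Lemma lifting_coefE f a N delta (j : 'I_n) :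
  lifting_coef f a N delta (delta j) =
  lifting_value f a N delta (lifting_coef f a N delta) j.
Proof.
rewrite /lifting_coef lifting_upto_stable //.
set eta := lifting_upto _ _ _ _ j; set eta' := lifting_upto _ _ _ _ n.
have eq_eta (l : 'I_n) : (l < j)%N -> eta (delta l) = eta' (delta l).
  by move=> lt_lj; rewrite /eta /eta' !lifting_upto_stable.
have [[S fS vS] leS] := lifting_valueP f a N delta eta j.
have [[S' fS' vS'] leS'] := lifting_valueP f a N delta eta' j.
apply/le_anti/andP; split.
- by rewrite vS' -(eq_objective f a eq_eta fS') leS.
- by rewrite vS (eq_objective f a eq_eta fS) leS'.
Qed.

Definition optimal f a N delta (j : 'I_n) (S : {set 'I_n}) : Prop :=
  let obj := objective f a delta (lifting_coef f a N delta) j in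
  feasible N delta j S /\ (forall S', feasible N delta j S' -> obj S <= obj S').

End Lifting.

(* Main.v *)
(* The problem at [j] says that [delta j] gets the largest coefficient for which
   [\sum_(i in S) eta i <= f (a(S))] for all feasible [S].  A set with at most
   one index per block is a point of a product of chains (one chain per block,
   plus a bottom), on which [S |-> f (a(S))] is submodular because [a] ascends
   along blocks and [f] is concave.  The block maxima of the successive prefixes
   form a chain of such points, tight for the inequality, and the values of
   [eta] on [wset] are the greedy increments along it; submodularity then gives
   the inequality for every feasible [S], and hence the optimality of [wset]. *)
Require Import Defs.
From mathcomp Require Import all_boot all_order all_fingroup all_algebra.
From mathcomp Require Import reals ring lra zify.
Import Order.TTheory GRing.Theory Num.Theory.
Local Open Scope ring_scope.

Set Implicit Arguments.
Unset Strict Implicit.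

(** * Diminishing returns and the greedy bound on a product of chains *)

Lemma concave_increment (R : realType) (f : R -> R) (x y d : R) :
  concave f -> x <= y -> 0 <= d -> f (y + d) - f y <= f (x + d) - f x.
Proof.
move=> conc_f; rewrite le_eqVlt => /predU1P[-> //|lt_xy] ge0_d.
pose s := y + d - x; have s_gt0 : 0 < s by rewrite /s; lra.
have s_neq0 : s != 0 by rewrite gt_eqF.
(* With this weight, [y] and [x + d] are complementary convex combinations of [x] and [y + d]; the
   two concavity inequalities are then added. *)
pose c := d / s.
have c_bnd : 0 <= c <= 1.
  by rewrite /c divr_ge0 ?(ltW s_gt0)//= ler_pdivrMr// mul1r /s; lra.
have c'_bnd : 0 <= 1 - c <= 1 by move: c_bnd; lra.
have csE : c * s = d by rewrite /c divfK.
have yE : c * x + (1 - c) * (y + d) = y.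
  by transitivity (y + d - c * s); [rewrite /s; ring | rewrite csE addrK].
have xE : (1 - c) * x + (1 - (1 - c)) * (y + d) = x + d.
  by transitivity (x + c * s); [rewrite /s; ring | rewrite csE].
have := conc_f x (y + d) c c_bnd; rewrite yE.
have := conc_f x (y + d) (1 - c) c'_bnd; rewrite xE.
nra.
Qed.

(* In a product of [t] chains with bottom 0, [u 0 <= u 1 <= ...] is a chain
   raised one coordinate at a time, and [E] is read off the submodular function
   [x |-> f (\sum_k A k (x k))] greedily along it: raising the cut
   [minn (s k) (u m k)] from [m] to [m + 1] costs at most the increment along
   the chain. *)
Lemma greedy_chain_bound (R : realType) (t M : nat) (f : R -> R)
    (D : 'I_t -> pred nat) (A E : 'I_t -> nat -> R) (u : nat -> 'I_t -> nat) :
  concave f -> f 0 = 0 ->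
  (forall k, A k 0%N = 0) -> (forall k, E k 0%N = 0) ->
  (forall k x y, D k x -> D k y -> (x <= y)%N -> A k x <= A k y) ->
  (forall k, D k 0%N) ->
  (forall k, u 0%N k = 0%N) ->
  (forall m k, (m <= M)%N -> D k (u m k)) ->
  (forall m, (m < M)%N -> exists2 k, (u m k <= u m.+1 k)%N &
     forall l, l != k -> u m.+1 l = u m l) ->
  (forall m k x, (m < M)%N -> D k x -> (u m k < x <= u m.+1 k)%N ->
     E k x = f (A k x + \sum_(l < t | l != k) A l (u m.+1 l))
             - \sum_(l < t | l != k) E l (u m.+1 l)) ->
  forall s : 'I_t -> nat, (forall k, D k (s k)) ->
  \sum_(k < t) E k (minn (s k) (u M k)) <=
    f (\sum_(k < t) A k (minn (s k) (u M k))).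
Proof.
move=> conc_f f0 A0 E0 monoA D0 u0 Du stepu defE s Ds.
have tight m : (m <= M)%N ->
    \sum_(k < t) E k (u m k) = f (\sum_(k < t) A k (u m k)).
  elim: m => [_|m IHm lt_mM].
    by rewrite !big1 ?f0// => k _; rewrite u0 (A0, E0).
  have [k le_u eq_u] := stepu m lt_mM.
  have [eq_k|ne_k] := eqVneq (u m k) (u m.+1 k).
    have uS l : u m.+1 l = u m l by have [->|/eq_u] := eqVneq l k.
    under eq_bigr do rewrite uS.
    by under [X in _ = f X]eq_bigr do rewrite uS; apply/IHm/ltnW.
  rewrite (bigD1 k)//= (defE m k)//; last 2 first.
  - exact: Du.
  - by rewrite ltn_neqAle ne_k le_u leqnn.
  by rewrite subrK [in RHS](bigD1 k).
have Dmin m k : (m <= M)%N -> D k (minn (s k) (u m k)).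
  by move=> le_mM; rewrite /minn; case: ifP => // _; apply: Du.
suff bound m : (m <= M)%N ->
    \sum_(k < t) E k (minn (s k) (u m k)) <=
      f (\sum_(k < t) A k (minn (s k) (u m k))) by exact: bound.
elim: m => [_|m IHm lt_mM].
  by rewrite !big1 ?f0// => k _; rewrite u0 minn0 (A0, E0).
have [k le_u eq_u] := stepu m lt_mM.
have [eq_k|ne_k] := eqVneq (minn (s k) (u m k)) (minn (s k) (u m.+1 k)).
  have uS l : minn (s l) (u m.+1 l) = minn (s l) (u m l).
    by have [->//|/eq_u->] := eqVneq l k.
  under eq_bigr do rewrite uS.
  by under [X in _ <= f X]eq_bigr do rewrite uS; apply/IHm/ltnW.
(* Since the cut moves, it agrees with the chain in coordinate [k] before the step, and [defE]
   applies to its new coordinate. *)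
have old : minn (s k) (u m k) = u m k by lia.
have lt_new : (u m k < minn (s k) (u m.+1 k) <= u m.+1 k)%N by lia.
have Dold := Du m k (ltnW lt_mM).
have := IHm (ltnW lt_mM); have := tight m (ltnW lt_mM).
have := defE m k _ lt_mM (Dmin m.+1 k lt_mM) lt_new.
have eq_off (F : 'I_t -> nat -> R) (v : 'I_t -> nat -> nat) :
    \sum_(l < t | l != k) F l (v l (u m.+1 l)) =
    \sum_(l < t | l != k) F l (v l (u m l)).
  by apply: eq_bigr => l /eq_u->.
have leA := monoA k _ _ Dold (Dmin m.+1 k lt_mM) (ltnW (proj1 (andP lt_new))).
rewrite !(bigD1 (P := xpredT) k)//= !(eq_off _ (fun=> id))
  !(eq_off _ (fun l => minn (s l))) old.
set i := minn _ _ in leA *.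
set B := \sum_(l | _) A l _; set b := \sum_(l | _) A l (minn _ _).
set eB := \sum_(l | _) E l _; set eb := \sum_(l | _) E l (minn _ _).
have le_bB : b <= B.
  apply: ler_sum => l _.
  by apply: monoA; rewrite ?geq_minr//; [apply: Dmin|apply: Du]; apply: ltnW.
(* As [b <= B], raising coordinate [k] gains at least as much over the cut as over the chain, where
   tightness makes the gain equal to the increment of [E]. *)
have := @concave_increment R f (A k (u m k) + b) (A k (u m k) + B)
  (A k i - A k (u m k)) conc_f.
rewrite lerD2l subr_ge0 => /(_ le_bB leA).
rewrite ![A k (u m k) + _ + _]addrC !addrA !subrK.
lra.
Qed.

(** The default [i0] need not satisfy [P], only some witness [i]: in [hpos] the default [j] fails
    [l < j]. *)
Lemma arg_minn_existsP (T : finType) (P : pred T) (F : T -> nat) (i0 i : T) :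
  P i -> extremum_spec leq P F [arg min_(l < i0 | P l) F l].
Proof.
move=> Pi; have := arg_minnP (i0 := i) F Pi.
rewrite /arg_min /extremum; case: pickP => // none /= [l Pl minl].
have /= := none l; rewrite Pl => /forallP; case=> l'.
by apply/implyP/minl.
Qed.

(** * Subsets of indices as levels of a chain *)

Section Levels.
Context {n : nat}.
Implicit Types (T : {set 'I_n}) (i : 'I_n).

(* Shifted by one, so that level 0 stands for the empty set. *)
Definition level T : nat := (\max_(i in T) i.+1)%N.

(** [g] carried over to levels, with value 0 at level 0. The sum has at most one term and avoids
    turning a number into an ordinal. *)
Definition at_level (R : realType) (g : 'I_n -> R) (x : nat) : R :=
  \sum_(i < n | i.+1 == x) g i.

Lemma at_level0 (R : realType) (g : 'I_n -> R) : at_level g 0 = 0.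
Proof. by rewrite /at_level big_pred0. Qed.

Lemma at_levelS (R : realType) (g : 'I_n -> R) i : at_level g i.+1 = g i.
Proof. by rewrite /at_level (big_pred1 i) // => l; rewrite eqSS. Qed.

Lemma level0 : level set0 = 0%N.
Proof. by rewrite /level big_set0. Qed.

Lemma level1 i : level [set i] = i.+1.
Proof. by rewrite /level big_set1. Qed.

Lemma leq_level T i : i \in T -> (i < level T)%N.
Proof. by move=> Ti; apply: (leq_bigmax_cond (F := fun i => i.+1)). Qed.

Lemma levelP T : level T = 0%N \/ exists2 i, i \in T & level T = i.+1.
Proof.
have [->|[i Ti]] := set_0Vmem T; first by left; apply: level0.
right; have T_gt0 : (0 < #|T|)%N by rewrite card_gt0; apply/set0Pn; exists i.
by have [l Tl eql] := eq_bigmax_cond (fun i => i.+1) T_gt0; exists l.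
Qed.

Lemma level_leqP T m :
  reflect (forall i, i \in T -> (i < m)%N) (level T <= m)%N.
Proof. exact: bigmax_leqP. Qed.

Lemma leq_levelS T T' : T \subset T' -> (level T <= level T')%N.
Proof. by move=> /subsetP sTT'; apply/level_leqP => i /sTT'/leq_level. Qed.

Lemma max_singletonP T i :
  reflect (i \in T /\ forall l, l \in T -> (l <= i)%N) (i \in max_singleton T).
Proof.
rewrite inE; apply: (iffP andP) => -[Ti max_i]; split=> //.
  by move=> l Tl; move/forallP/(_ l): max_i; rewrite Tl.
by apply/forallP => l; apply/implyP/max_i.
Qed.

Lemma level_max_singleton T : level (max_singleton T) = level T.
Proof.
apply/eqP; rewrite eqn_leq leq_levelS ?subsetIl//=; last first.
  by apply/subsetP => i /max_singletonP[].
have [->//|[i Ti lev_i]] := levelP T; rewrite lev_i.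
apply/leq_level/max_singletonP; split=> // l /leq_level.
by rewrite lev_i.
Qed.

Lemma card_max_singleton T : (#|max_singleton T| <= 1)%N.
Proof.
apply/card_le1P => i /max_singletonP[Ti max_i] l.
apply/idP/eqP => [/max_singletonP[Tl max_l]|->]; last exact/max_singletonP.
by apply/val_inj/anti_leq; rewrite max_i ?max_l.
Qed.

Lemma sum_at_level (R : realType) (g : 'I_n -> R) T :
  (#|T| <= 1)%N -> \sum_(i in T) g i = at_level g (level T).
Proof.
rewrite leq_eqVlt ltnS leqn0 cards_eq0 => /orP[/cards1P[i ->]|/eqP->].
  by rewrite big_set1 level1 at_levelS.
by rewrite big_set0 level0 at_level0.
Qed.

End Levels.

(** * Blocks, prefixes, block maxima and [hpos] *)

Section Partition.
Context {n t : nat} (N : 'I_t -> {set 'I_n}) (hN : consecutive_partition N).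
Implicit Types (delta : {perm 'I_n}) (S : {set 'I_n}).

Lemma block_mem_ex i : exists k, i \in N k.
Proof.
have [_ /and3P[/eqP cov _ _] _] := hN.
have : i \in cover (blocks N) by rewrite cov inE.
by case/bigcupP => B /imsetP[k _ ->]; exists k.
Qed.

Lemma block_mem_inj i k l : i \in N k -> i \in N l -> k = l.
Proof.
have [injN /and3P[_ tri _] _] := hN => Nki Nli; apply: injN.
by rewrite -(def_pblock tri _ Nki) ?(def_pblock tri _ Nli)//; apply: imset_f.
Qed.

Lemma block_ofE i k : i \in N k -> block_of N i = N k.
Proof.
have [_ /and3P[_ tri _] _] := hN.
by move=> Nki; apply: def_pblock => //; apply: imset_f.
Qed.

(** The passage from sets meeting each block at most once to points of the product of chains. *)
Lemma sum_block_levels (R : realType) (g : 'I_n -> R) S :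
  (forall k, (#|S :&: N k| <= 1)%N) ->
  \sum_(i in S) g i = \sum_(k < t) at_level g (level (S :&: N k)).
Proof.
move=> S1; have [b bP] : exists b : 'I_n -> 'I_t, forall i, i \in N (b i).
  exists (fun i => xchoose (block_mem_ex i)) => i; exact: (xchooseP (block_mem_ex i)).
rewrite (partition_big b xpredT)//=; apply: eq_bigr => k _.
rewrite -sum_at_level//; apply: eq_bigl => i; rewrite inE.
congr (_ && _); apply/eqP/idP => [<-//|]; exact: block_mem_inj (bP i).
Qed.

Lemma mem_prefix delta m (l : 'I_n) : (delta l \in Defs.prefix delta m) = (l < m)%N.
Proof.
apply/imsetP/idP => [[l']|lt_lm]; last by exists l; rewrite ?inE.
by rewrite inE => lt_l'm /perm_inj->.
Qed.

Lemma prefixP delta m i :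
  reflect (exists2 l : 'I_n, (l < m)%N & i = delta l) (i \in Defs.prefix delta m).
Proof.
by apply: (iffP imsetP) => -[l lt_lm ->]; exists l; rewrite ?inE// in lt_lm *.
Qed.

Lemma prefixS delta m m' : (m <= m')%N ->
  Defs.prefix delta m \subset Defs.prefix delta m'.
Proof.
move=> le_m; apply/subsetP => i /prefixP[l lt_lm ->].
by rewrite mem_prefix (leq_trans lt_lm).
Qed.

Lemma blockmaximaI delta m k :
  blockmaxima N delta m :&: N k = max_singleton (N k :&: Defs.prefix delta m).
Proof.
apply/setP => i; rewrite inE; apply/andP/idP => [[/bigcupP[l _ max_i] Nki]|max_i].
  have /max_singletonP[] := max_i; rewrite inE => /andP[Nli _] _.
  by rewrite (block_mem_inj Nki Nli).
split; first by apply/bigcupP; exists k.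
by have /max_singletonP[] := max_i; rewrite inE => /andP[].
Qed.

Lemma blockmaxima_sub delta m : blockmaxima N delta m \subset Defs.prefix delta m.
Proof.
apply/bigcupsP => k _; apply/subsetP => i /max_singletonP[].
by rewrite inE => /andP[].
Qed.

(* [hpos] is the first time an index at least [delta j] of its block shows up. *)
Lemma hposP delta (j : 'I_n) k : delta j \in N k ->
  let h := hpos N delta j in
  [/\ (h <= j)%N, delta h \in N k, (delta j <= delta h)%N &
      forall l : 'I_n, (l < h)%N -> delta l \in N k -> (delta l < delta j)%N].
Proof.
move=> Nj /=; rewrite /hpos (block_ofE Nj).
have neq_delta (l : 'I_n) : (l < j)%N -> delta l != delta j :> nat.
  by move=> lt_lj; rewrite (inj_eq val_inj) (inj_eq perm_inj) neq_ltn lt_lj.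
case: ifPn => [/max_singletonP[_ max_j]|nmax_j].
  split=> // l lt_lj Nl; rewrite ltn_neqAle neq_delta//=.
  by apply: max_j; rewrite inE Nl mem_prefix ltnS ltnW.
have [l [lt_lj Nl gt_l]] : exists l : 'I_n,
    [/\ (l < j)%N, delta l \in N k & (delta j < delta l)%N].
  move: nmax_j; rewrite inE negb_and inE Nj mem_prefix ltnSn /=.
  rewrite negb_forall => /existsP[i]; rewrite negb_imply -ltnNge inE.
  case/andP=> /andP[Ni /prefixP[l lt_lj def_i]]; subst i => gt_l.
  exists l; split=> //; rewrite ltn_neqAle -ltnS lt_lj andbT.
  by apply: contraTneq gt_l => /val_inj->; rewrite ltnn.
case: (@arg_minn_existsP _ _ (fun l : 'I_n => l : nat) j l) => [|h].
  by apply/and3P.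
case/and3P=> lt_hj gt_h Nh min_h; split=> //; try exact: ltnW.
move=> l' lt_l'h Nl'; have lt_l'j := ltn_trans lt_l'h lt_hj.
rewrite ltnNge; apply/negP => le_jl'.
suff /min_h : [&& (l' < j)%N, (delta j < delta l')%N & delta l' \in N k].
  by rewrite leqNgt lt_l'h.
by rewrite lt_l'j Nl' ltn_neqAle eq_sym neq_delta ?le_jl'.
Qed.

Lemma hpos_unique delta (j h : 'I_n) k :
  delta j \in N k -> delta h \in N k -> (delta j <= delta h)%N ->
  (forall l : 'I_n, (l < h)%N -> delta l \in N k -> (delta l < delta j)%N) ->
  hpos N delta j = h.
Proof.
move=> Nj Nh le_jh min_h; have [_ Nh' le_jh' min_h'] := hposP Nj.
have le_hh' : (hpos N delta j <= h)%N.
  by rewrite leqNgt; apply/negP => /min_h'/(_ Nh); rewrite ltnNge le_jh.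
have le_h'h : (h <= hpos N delta j)%N.
  by rewrite leqNgt; apply/negP => /min_h/(_ Nh'); rewrite ltnNge le_jh'.
by apply/val_inj/anti_leq; rewrite le_hh' le_h'h.
Qed.

(** Entries of the block before position [hpos] are below [delta j], hence below the entry at
    [hpos]. *)
Lemma hpos_max delta (j : 'I_n) k : delta j \in N k ->
  delta (hpos N delta j)
    \in max_singleton (N k :&: Defs.prefix delta (hpos N delta j).+1).
Proof.
move=> Nj; have [_ Nh le_jh min_h] := hposP Nj.
apply/max_singletonP; split; first by rewrite inE Nh mem_prefix ltnSn.
move=> i; rewrite inE => /andP[Ni /prefixP[l lt_l def_i]]; subst i.
move: lt_l; rewrite ltnS leq_eqVlt => /predU1P[/val_inj->//|lt_l].
by apply: leq_trans le_jh; apply/ltnW/min_h.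
Qed.

Lemma blockmaximaD1 delta (j : 'I_n) k : delta j \in N k ->
  (blockmaxima N delta (hpos N delta j).+1 :\ delta (hpos N delta j)) :&: N k
    = set0.
Proof.
move=> Nj; rewrite setIDAC blockmaximaI; apply/eqP; rewrite setD_eq0.
apply/subsetP => i max_i; have /card_le1P := card_max_singleton
  (N k :&: Defs.prefix delta (hpos N delta j).+1).
by move/(_ _ (hpos_max Nj) i); rewrite max_i => /esym; rewrite !inE.
Qed.

Lemma wset_block delta (j : 'I_n) k : delta j \in N k ->
  wset N delta j :&: N k = [set delta j].
Proof.
move=> Nj; rewrite /wset setIUl blockmaximaD1// set0U.
by apply/setIidPl; rewrite sub1set.
Qed.

(** The removed and the inserted index both lie in block [k], so the other blocks keep their
    maxima. *)
Lemma wset_off_block delta (j : 'I_n) k l : delta j \in N k -> l != k ->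
  wset N delta j :&: N l =
    max_singleton (N l :&: Defs.prefix delta (hpos N delta j).+1).
Proof.
move=> Nj ne_lk; have [_ Nh _ _] := hposP Nj.
have off i : i \in N k -> i \notin N l.
  by move=> Ni; apply: contraNN ne_lk => /(block_mem_inj Ni)->.
rewrite /wset setIUl setIDAC blockmaximaI.
apply/setP => i; rewrite !inE.
have [->|_] := eqVneq i (delta (hpos _ _ _)).
  by rewrite (negPf (off _ Nh)) !andbF.
by have [->|_] := eqVneq i (delta j); rewrite ?(negPf (off _ Nj)) ?orbF.
Qed.

Lemma wset_feasible delta (j : 'I_n) : feasible N delta j (wset N delta j).
Proof.
have [k Nj] := block_mem_ex (delta j); have [le_hj _ _ _] := hposP Nj.
apply/and3P; split; last by rewrite !inE eqxx orbT.
- rewrite subUset sub1set mem_prefix ltnSn andbT.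
  apply: subset_trans (subsetDl _ _) _.
  by apply: subset_trans (blockmaxima_sub _ _) _; apply: prefixS.
- apply/forallP => l; have [->|ne_lk] := eqVneq l k.
    by rewrite wset_block// cards1.
  by rewrite (wset_off_block Nj ne_lk) card_max_singleton.
Qed.

(** * The chain of block maxima in coordinates *)

Definition block_level delta (m : nat) (k : 'I_t) : nat :=
  level (N k :&: Defs.prefix delta m).

(** [wset] is the chain point after [(hpos N delta j).+1] steps, with coordinate [k] lowered to the
    level of [delta j]. *)
Lemma sum_wset (R : realType) (g : 'I_n -> R) delta (j : 'I_n) k :
  delta j \in N k ->
  \sum_(i in wset N delta j) g i = g (delta j) +
    \sum_(l < t | l != k) at_level g (block_level delta (hpos N delta j).+1 l).
Proof.
move=> Nj; have /and3P[_ /forallP W1 _] := wset_feasible delta j.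
rewrite sum_block_levels// (bigD1 k)//= wset_block// level1 at_levelS.
congr (_ + _); apply: eq_bigr => l ne_lk.
by rewrite (wset_off_block Nj ne_lk) level_max_singleton.
Qed.

Lemma sum_wsetD1 (R : realType) (g : 'I_n -> R) delta (j : 'I_n) k :
  delta j \in N k ->
  \sum_(i in wset N delta j :\ delta j) g i =
    \sum_(l < t | l != k) at_level g (block_level delta (hpos N delta j).+1 l).
Proof.
move=> Nj; apply: (addrI (g (delta j))); rewrite -sum_wset//.
have /and3P[_ _ Wj] := wset_feasible delta j.
by rewrite [RHS](big_setD1 _ Wj).
Qed.

Lemma block_level_step delta (m : 'I_n) :
  exists2 k, (block_level delta m k <= block_level delta m.+1 k)%N &
    forall l, l != k -> block_level delta m.+1 l = block_level delta m l.
Proof.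
have [k Nm] := block_mem_ex (delta m); exists k.
  by apply/leq_levelS/setIS/prefixS.
move=> l ne_lk; congr level; apply/setP => i; rewrite !inE.
case Nli: (i \in N l) => //=; apply/prefixP/prefixP => -[p lt_p def_i].
  exists p => //; move: lt_p; rewrite ltnS leq_eqVlt.
  case/predU1P=> // /val_inj eq_p; subst p i.
  by rewrite (block_mem_inj Nli Nm) eqxx in ne_lk.
by exists p => //; apply: ltnW.
Qed.

(** The step at which the block first reaches level [(delta j).+1] reveals its first entry at least
    [delta j]; the shift by one in levels moves the strict inequality to the right. *)
Lemma hpos_of_level delta (j m : 'I_n) k : delta j \in N k ->
  (block_level delta m k <= delta j < block_level delta m.+1 k)%N ->
  hpos N delta j = m.
Proof.
move=> Nj /andP[/level_leqP le_lev lt_lev].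
have small (l : 'I_n) : (l < m)%N -> delta l \in N k -> (delta l < delta j)%N.
  by move=> lt_lm Nl; apply: le_lev; rewrite inE Nl mem_prefix.
have [l [lt_lm Nl le_jl]] : exists l : 'I_n,
    [/\ (l < m.+1)%N, delta l \in N k & (delta j <= delta l)%N].
  move: lt_lev; rewrite /block_level.
  have [->//|[i]] := levelP (N k :&: Defs.prefix delta m.+1).
  rewrite inE => /andP[Ni /prefixP[l lt_l def_i]] ->; subst i.
  by rewrite ltnS; exists l.
move: lt_lm; rewrite ltnS leq_eqVlt => /predU1P[/val_inj eq_l|lt_lm].
  by subst l; apply: hpos_unique small.
by have := small l lt_lm Nl; rewrite ltnNge le_jl.
Qed.

(** * Validity of the inequality and optimality of [wset] *)

(** This is [greedy_chain_bound] for the chain of block maxima. It asks for the formula for [eta]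
    only up to [j], as an induction on [j] requires. *)
Lemma prefix_valid_bound (R : realType) (f : R -> R) (a : 'rV[R]_n)
    delta (eta : 'I_n -> R) (j : 'I_n) S :
  concave f -> f 0 = 0 -> (forall i, 0 <= a 0 i) -> block_ascending N a ->
  (forall l : 'I_n, (l <= j)%N ->
     eta (delta l) = objective f a delta eta l (wset N delta l)) ->
  feasible N delta j S ->
  \sum_(i in S) eta i <= f (\sum_(i in S) a 0 i).
Proof.
move=> conc_f f0 a_ge0 asc_a defeta /and3P[sS /forallP S1 _].
pose T k := N k :&: Defs.prefix delta j.+1.
(* Levels are restricted to indices of block [k] in the prefix: there [a] ascends and [defeta] is
   available. *)
pose D k x := (x == 0%N) || [exists i in T k, x == i.+1].
have Dlevel k (T' : {set 'I_n}) : T' \subset T k -> D k (level T').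
  move=> /subsetP sT'; rewrite /D; have [->//|[i /sT' Ti ->]] := levelP T'.
  by apply/existsP; exists i; rewrite Ti eqxx.
have monoA k x y : D k x -> D k y -> (x <= y)%N ->
    at_level (a 0) x <= at_level (a 0) y.
  have Dpos z : (z == 0%N) || [exists i in T k, z == i.+1] ->
      z = 0%N \/ exists2 i, i \in N k & z = i.+1.
    case/predU1P=> [|/existsP[i /andP[]]]; first by left.
    by rewrite inE => /andP[Ni _] /eqP; right; exists i.
  (* Against level 0 the comparison is nonnegativity of [a]; between two indices it is the ascent in
     the block. *)
  move=> /Dpos[->|[i Ni ->]] /Dpos[->|[l Nl ->]]; rewrite ?at_level0 ?at_levelS//.
  exact: (asc_a k).
have := @greedy_chain_bound R t j.+1 f D (fun=> at_level (a 0))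
  (fun=> at_level eta) (block_level delta) conc_f f0 (fun=> at_level0 _)
  (fun=> at_level0 _) monoA.
(* [S] lies in the prefix, so cutting its levels by the last chain point changes nothing. *)
have le_lev k : (level (S :&: N k) <= block_level delta j.+1 k)%N.
  by rewrite setIC; apply/leq_levelS/setIS.
rewrite !sum_block_levels//.
under [in X in _ -> X]eq_bigr => k _ do rewrite -(minn_idPl (le_lev k)).
under [in X in _ -> _ <= f X]eq_bigr => k _ do rewrite -(minn_idPl (le_lev k)).
apply=> [||m k le_m|m lt_m|m k x lt_m|k].
- by [].
- move=> k; rewrite /block_level (_ : _ :&: _ = set0) ?level0//.
  by apply/setP => i; rewrite !inE; apply/andP => -[_ /prefixP[]].
- exact/Dlevel/setIS/prefixS.
- exact: (block_level_step delta (Ordinal (leq_trans lt_m (ltn_ord j)))).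
- case/predU1P=> [->//|/existsP[i /andP[]]].
  rewrite inE => /andP[Ni /prefixP[l]]; rewrite ltnS => le_lj def_i /eqP -> lev_l.
  (* The level is reached at step [m], so [hpos] is [m] and the formula on [wset] is the greedy
     increment. *)
  subst i; rewrite !at_levelS defeta// /objective (sum_wset _ Ni) (sum_wsetD1 _ Ni).
  by rewrite (hpos_of_level (m := Ordinal (leq_trans lt_m (ltn_ord j))) Ni).
- by rewrite setIC; apply/Dlevel/setIS.
Qed.

(** Strong induction on [j]. The bound presupposes the formula at [j] itself, so it is applied to a
    modified [eta']; the objective at [j] does not read the coefficient of [delta j], which allows
    the return to [eta]. *)
Lemma lifting_coef_wset (R : realType) (f : R -> R) (a : 'rV[R]_n) delta
    (j : 'I_n) :
  concave f -> f 0 = 0 -> (forall i, 0 <= a 0 i) -> block_ascending N a ->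
  let eta := lifting_coef f a N delta in
  eta (delta j) = objective f a delta eta j (wset N delta j) /\
  optimal f a N delta j (wset N delta j).
Proof.
move=> conc_f f0 a_ge0 asc_a eta.
have [m] := ubnP (j : nat); elim: m j => // m IHm j; rewrite ltnS => le_jm.
have fW := wset_feasible delta j.
(* [eta'] is what [eta] has to be if [wset] is optimal at [j]. *)
pose eta' i := if i == delta j then objective f a delta eta j (wset N delta j)
               else eta i.
have eq_eta (l p : 'I_n) : (p <= j)%N -> (l < p)%N ->
    eta' (delta l) = eta (delta l).
  move=> le_pj lt_lp; rewrite /eta' (inj_eq perm_inj) ifN//.
  by apply: contraTneq lt_lp => ->; rewrite -leqNgt.
have eq_obj (l : 'I_n) S' : (l <= j)%N -> feasible N delta l S' ->
    objective f a delta eta' l S' = objective f a delta eta l S'.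
  by move=> le_lj; apply: eq_objective => p; apply: eq_eta.
have defeta' (l : 'I_n) : (l <= j)%N ->
    eta' (delta l) = objective f a delta eta' l (wset N delta l).
  move=> le_lj; rewrite eq_obj//; last exact: wset_feasible.
  rewrite /eta' (inj_eq perm_inj); case: eqVneq => [->//|ne_lj].
  by apply: (proj1 (IHm l _)); apply: leq_trans le_jm; rewrite ltn_neqAle ne_lj.
have minW S' : feasible N delta j S' ->
    objective f a delta eta j (wset N delta j) <= objective f a delta eta j S'.
  (* Isolating the term of [delta j] turns the bound for [S'] into the comparison of objectives. *)
  move=> fS'; have := prefix_valid_bound conc_f f0 a_ge0 asc_a defeta' fS'.
  have /and3P[_ _ S'j] := fS'; rewrite (big_setD1 _ S'j)/= {1}/eta' eqxx.
  by rewrite -lerBrDr -[leRHS]/(objective f a delta eta' j S') eq_obj.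
split=> //; rewrite /eta lifting_coefE.
have [[S' fS' vS'] leS'] := lifting_valueP f a N delta eta j.
by apply/le_anti; rewrite leS'// vS' minW.
Qed.

End Partition.

Unset Implicit Arguments.

Theorem theorem3p4 (R : realType) (n t : nat) (hn : (0 < n)%N) (ht : (0 < t)%N)
    (f : R -> R) (hf : concave f) (hf0 : f 0 = 0)
    (a : 'rV[R]_n) (ha : forall i : 'I_n, 0 <= a 0 i)
    (N : 'I_t -> {set 'I_n}) (hN : consecutive_partition N)
    (haN : block_ascending N a)
    (delta : {perm 'I_n}) (j : 'I_n) :
  let eta := lifting_coef f a N delta in
  let W := wset N delta j in
  optimal f a N delta j W /\
  eta (delta j) = f (\sum_(i in W) a 0 i) - \sum_(i in W :\ delta j) eta i.
Proof.
by have [] := lifting_coef_wset hN delta j hf hf0 ha haN.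
Qed.
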